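(* Let $Z$ be an $n\times n$ positive semidefinite complex matrix with eigenvalues $r_1,\dots,r_n$, and let $U$ be an $n\times n$ unitary matrix such that $I-UZ$ is nonsingular. Then $$\prod_{k=1}^n\frac{|1-r_k|}{1+r_k}\le \frac{|\det(I-Z^2)|}{|\det(I-UZ)|^2},$$ with equality if and only if $1$ is an eigenvalue of $Z$, or the eigenvalues of $UZ$ (with multiplicities) are $-r_1,\dots,-r_n$. If both $Z$ and $I-Z$ are nonsingular and $U\neq -I$, this inequality is strict. Moreover, if $0\le r_k<1$ for all $k=1,\dots,n$, then $$\frac{\det(I-Z^2)}{|\det(I-UZ)|^2}\le \prod_{k=1}^n\frac{1+r_k}{1-r_k},$$ with equality if and only if the eigenvalues of $UZ$ (with multiplicities) are $r_1,\dots,r_n$. If in addition $Z$ is nonsingular and $U\neq I$, this inequality is strict.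
   Context: $I$ denotes the $n\times n$ identity matrix. *)

(* Defs.v *)
From HB Require Import structures.
From mathcomp Require Import all_boot all_order all_algebra.
From mathcomp Require Import sesquilinear spectral.
Set Implicit Arguments. Unset Strict Implicit. Unset Printing Implicit Defensive.
Import Order.TTheory GRing.Theory Num.Theory Num.Def.
Local Open Scope ring_scope.
Local Open Scope sesquilinear_scope.


Definition psdmx (C : numClosedFieldType) (n : nat) (Z : 'M[C]_n) : Prop :=
  Z ^t conjC = Z /\ forall v : 'rV[C]_n, 0 <= (v *m Z *m v ^t conjC) 0 0.

(* Main.v *)
(** Diagonalizing [Z = P^* D P] with [D = diag(r)] and conjugating [U] by [P],
    both inequalities say that
    [prod (1 - r_k) <= |det (I - U D)| <= prod (1 + r_k)].
    The upper bound is Hadamard's inequality for [A = I - U D], whose [k]-th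
    column has squared norm [1 + r_k^2 - 2 r_k Re u_kk <= (1 + r_k)^2].
    For the lower bound, apply Hadamard's inequality to [V = T A^-1 T] with
    [T = (I - D^2)^(1/2)]: unitarity of [U] gives [V^* V = V + V^* - T^2], so the
    squared norm [x] of the [k]-th column satisfies
    [|v_kk|^2 <= x <= 2 |v_kk| - (1 - r_k^2)], hence [x <= (1 + r_k)^2].
    Equality in Hadamard's bound fixes every column and forces [U Z = - Z],
    respectively [U Z = Z]; conversely the determinant is the value at [1] of the
    characteristic polynomial of [U Z]. *)
Require Import Defs.
From HB Require Import structures.
From mathcomp Require Import all_boot all_order all_algebra all_fingroup.
From mathcomp Require Import sesquilinear spectral ring.
Import Order.TTheory GRing.Theory Num.Theory.
Local Open Scope ring_scope.
Local Open Scope sesquilinear_scope.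

(** One strict factor would make the whole product strictly smaller, since the remaining [b j] are
    positive. This carries equality in Hadamard's bound over to every column. *)
Lemma prodr_eq_bound (R : numDomainType) (I : finType) (a b : I -> R) :
  (forall i, 0 <= a i <= b i) -> (forall i, 0 < b i) ->
  \prod_i a i = \prod_i b i -> forall i, a i = b i.
Proof.
move=> le_ab b_gt0 eq_ab i.
have [a_ge0 {}leab] := andP (le_ab i).
apply/eqP; move: leab; rewrite le_eqVlt => /orP[//|lt_ab].
suff: \prod_i a i < \prod_i b i by rewrite eq_ab ltxx.
rewrite (bigD1 i) //= [ltRHS](bigD1 i) //=.
apply: (@le_lt_trans _ _ (a i * \prod_(j | j != i) b j)).
  by apply: ler_wpM2l => //; apply: ler_prod => j _.
by rewrite ltr_pM2r // prodr_gt0.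
Qed.

(** * Gram matrices, Hadamard's inequality and scalar estimates *)

Section Gram.
Variable C : numClosedFieldType.

Lemma gram_diagE n (A : 'M[C]_n) k :
  (A^t* *m A) k k = \sum_i `|A i k| ^+ 2.
Proof. by rewrite mxE; apply: eq_bigr => i _; rewrite !mxE normCKC. Qed.

Lemma gram_diag_ge0 n (A : 'M[C]_n) k : 0 <= (A^t* *m A) k k.
Proof. by rewrite gram_diagE sumr_ge0 // => i _; rewrite exprn_ge0. Qed.

Lemma gram_diag_ge n (A : 'M[C]_n) i k :
  `|A i k| ^+ 2 <= (A^t* *m A) k k.
Proof.
rewrite gram_diagE (bigD1 i) //= lerDl sumr_ge0 // => j _.
by rewrite exprn_ge0.
Qed.

Lemma gram_diag_eq n (A : 'M[C]_n) k :
  (A^t* *m A) k k = `|A k k| ^+ 2 -> forall i, i != k -> A i k = 0.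
Proof.
rewrite gram_diagE (bigD1 k) //= -[RHS]addr0 => /addrI/psumr_eq0P Ak0 i ik.
have /eqP: `|A i k| ^+ 2 = 0 by apply: Ak0 => // j _; rewrite exprn_ge0.
by rewrite expf_eq0 /= normr_eq0 => /eqP.
Qed.

(** Row [i] of [A] lies in the span of the Schmidt rows of index at most [i], which are orthogonal
    to row [j] for [j > i]. This yields the factorization of [A] as lower triangular times
    unitary. *)
Lemma schmidt_trig n (A : 'M[C]_n) : is_trig_mx (A *m ((schmidt A)^t*)).
Proof.
apply/is_trig_mxP => i j lt_ij.
have Bu : schmidt A \is unitarymx by apply: schmidt_unitarymx.
set B := schmidt A in Bu *.
have sAB : (row i A <= kermx ((row j B)^t*))%MS.
  apply: (submx_trans (row_schmidt_sub A i)); apply/sumsmx_subP => k le_ki.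
  rewrite genmxE; apply/sub_kermxP/matrixP => a b; rewrite !ord1.
  have := row_unitarymxP Bu k j; rewrite dotmxE => ->; rewrite mxE.
  by rewrite -val_eqE /= ltn_eqF // (leq_ltn_trans le_ki).
have /sub_kermxP/matrixP/(_ 0 0) := sAB.
by rewrite !mxE => AB0; rewrite -[RHS]AB0; apply: eq_bigr => k _; rewrite !mxE.
Qed.

Lemma norm_det_unitary n (U : 'M[C]_n) : U \is unitarymx -> `|\det U| = 1.
Proof.
move=> /unitarymxP/(congr1 determinant); rewrite det_mulmx det1 det_map_mx det_tr.
by rewrite -normCK => /eqP; rewrite sqrp_eq1 ?normr_ge0 // => /eqP.
Qed.

(** Write [A = L *m B] with [L] lower triangular and [B] unitary. Then [A] and [L] have the same row
    norms and the same absolute determinant, and each diagonal entry of [L] is bounded by the norm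
    of its row. *)
Lemma hadamard_row n (A : 'M[C]_n) :
  `|\det A| ^+ 2 <= \prod_k (A *m A^t*) k k.
Proof.
have Bu : schmidt A \is unitarymx by apply: schmidt_unitarymx.
have trL := schmidt_trig _ A.
set B := schmidt A in Bu trL *; set L := A *m B^t* in trL *.
have AE : A = L *m B by rewrite /L mulmxKtV.
have -> : A *m A^t* = L *m L^t*.
  by rewrite AE trmx_mul map_mxM mulmxA mulmxtVK.
rewrite AE det_mulmx normrM (@norm_det_unitary _ B) // mulr1.
rewrite det_trig //.
rewrite normr_prod -prodrXl; apply: ler_prod => k _; rewrite exprn_ge0 //=.
rewrite [leRHS]mxE (bigD1 k) //= !mxE -normCK lerDl sumr_ge0 // => j _.
by rewrite !mxE -normCK exprn_ge0.
Qed.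

Lemma hadamard n (A : 'M[C]_n) :
  `|\det A| ^+ 2 <= \prod_k (A^t* *m A) k k.
Proof.
rewrite -det_tr (le_trans (hadamard_row _ A^T)) //.
rewrite le_eqVlt; apply/orP; left; apply/eqP; apply: eq_bigr => k _.
by rewrite !mxE; apply: eq_bigr => i _; rewrite !mxE mulrC.
Qed.

Lemma addC_conjC_le (z : C) : z + z^* <= 2 * `|z|.
Proof.
have [le_z _] := leif_Re_Creal z.
by rewrite -ler_pdivrMl ?ltr0n // mulrC -ReE.
Qed.

Lemma addC_conjC_eq (z : C) : z + z^* = 2 * `|z| -> z = `|z|.
Proof.
move=> eq_z; apply/esym/normr_idP; rewrite -(leif_Re_Creal z) ReE eq_z.
by rewrite mulrAC divff ?mul1r // pnatr_eq0.
Qed.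


(** Eliminating [x] and completing the square leaves [(y - 1) ^+ 2 <= d ^+ 2]. *)
Lemma sqr_sub_bound (x y d : C) : 0 <= y -> 0 <= d ->
  y ^+ 2 <= x -> x <= 2 * y - (1 - d ^+ 2) -> y <= 1 + d.
Proof.
move=> y0 d0 yx xy; rewrite real_leNgt ?ger0_real ?addr_ge0 ?ler01 //.
apply/negP => lt_dy.
have : (y - 1) ^+ 2 <= d ^+ 2.
  rewrite -subr_ge0 (_ : _ - _ = (2 * y - (1 - d ^+ 2)) - y ^+ 2); last by ring.
  by rewrite subr_ge0 (le_trans yx).
have lt_d : d < y - 1 by rewrite ltrBrDl.
by rewrite ler_pXn2r ?nnegrE ?(le_trans d0 (ltW lt_d)) // lt_geF.
Qed.

(** * Bounds on the determinant of [1 - U D] for diagonal [D]: the upper bound *)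

Section DiagonalBounds.
Variables (n : nat) (U : 'M[C]_n) (d : 'I_n -> C).
Hypothesis U_unitary : U \is unitarymx.
Hypothesis d_ge0 : forall k, 0 <= d k.
Local Notation D := (diag_mx (\row_k d k)).
Local Notation A := (1%:M - U *m D).

Lemma mulmx_D (M : 'M_n) i j : (M *m D) i j = M i j * d j.
Proof. by rewrite mul_mx_diag !mxE. Qed.

Lemma conjC_d k : (d k)^* = d k.
Proof. by rewrite geC0_conj. Qed.

Lemma adj_D : D^t* = D.
Proof.
by apply/matrixP => i j; rewrite !mxE rmorphMn /= conjC_d; case: eqVneq => [->|].
Qed.

Lemma gram_U : U^t* *m U = 1%:M.
Proof. by apply/mulmx1C/unitarymxP. Qed.

Lemma adj_A : A^t* = 1%:M - (U *m D)^t*.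
Proof. by rewrite linearB /= map_mxB /= trmx1 map_mx1. Qed.

(** Unitarity of [U] collapses the quadratic term of the expansion to [D *m D]. *)
Lemma gram_A : A^t* *m A = A^t* + A - (1%:M - D *m D).
Proof.
rewrite adj_A mulmxBl mul1mx mulmxBr mulmx1.
have -> : (U *m D)^t* *m (U *m D) = D *m D.
  by rewrite trmx_mul map_mxM adj_D mulmxA -(mulmxA D) gram_U mulmx1.
apply/matrixP => i j.
move: ((U *m D)^t*) (U *m D) (D *m D) => X Y Z.
by rewrite !mxE; ring.
Qed.

Lemma diag_A k : A k k = 1 - d k * U k k.
Proof. by rewrite 2!mxE eqxx [X in _ + X]mxE mulmx_D mulrC. Qed.

Lemma diag_subD2 k : (1%:M - D *m D) k k = 1 - d k ^+ 2.
Proof. by rewrite 2!mxE eqxx [X in _ + X]mxE mulmx_D !mxE eqxx. Qed.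

(** Written as the target bound minus a nonnegative defect, so that the bound and its equality case
    can both be read off. *)
Lemma gram_A_diag k :
  (A^t* *m A) k k = (1 + d k) ^+ 2 - d k * (2 + (U k k + (U k k)^*)).
Proof.
rewrite gram_A; transitivity ((A k k)^* + A k k - (1%:M - D *m D) k k).
  by move: A (1%:M - D *m D) => X Y; rewrite !mxE.
rewrite diag_subD2 diag_A rmorphB rmorphM rmorph1 /= conjC_d; ring.
Qed.

Lemma norm_U_diag k : `|U k k| <= 1.
Proof.
rewrite -(@ler_pXn2r _ 2) ?nnegrE // expr1n.
by rewrite (le_trans (gram_diag_ge _ U k k)) // gram_U mxE eqxx.
Qed.

Lemma addC_conjC_U_ge0 k : 0 <= 2 + (U k k + (U k k)^*).
Proof.
have := addC_conjC_le (- U k k); rewrite normrN rmorphN /= -opprD.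
move=> le2; rewrite -[_ + _^*]opprK subr_ge0 (le_trans le2) //.
by rewrite ler_piMr ?norm_U_diag.
Qed.

Lemma gram_A_diag_le k : (A^t* *m A) k k <= (1 + d k) ^+ 2.
Proof. by rewrite gram_A_diag gerBl mulr_ge0 ?addC_conjC_U_ge0. Qed.

Lemma add1d_gt0 k : 0 < 1 + d k.
Proof. by rewrite ltr_pwDl. Qed.

Lemma det_one_sub_le : `|\det A| <= \prod_k (1 + d k).
Proof.
rewrite -(@ler_pXn2r _ 2) ?nnegrE ?prodr_ge0 // => [|k _]; last exact/ltW/add1d_gt0.
rewrite (le_trans (hadamard _ A)) // -prodrXl; apply: ler_prod => k _.
by rewrite gram_diag_ge0 gram_A_diag_le.
Qed.

Lemma det_one_sub_eq : `|\det A| = \prod_k (1 + d k) -> U *m D = - D.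
Proof.
move=> eq_det.
have eq_gram k : (A^t* *m A) k k = (1 + d k) ^+ 2.
  move: k; apply: prodr_eq_bound => [k|k|].
    by rewrite gram_diag_ge0 gram_A_diag_le.
    by rewrite exprn_gt0 ?add1d_gt0.
  apply/le_anti/andP; split.
    by apply: ler_prod => k _; rewrite gram_diag_ge0 gram_A_diag_le.
  by rewrite prodrXl -eq_det hadamard.
apply/matrixP=> i k; rewrite mulmx_D !mxE.
(* If [d k = 0], column [k] vanishes on both sides and nothing about [U] is claimed. *)
have [dk0|dk0] := eqVneq (d k) 0.
  by case: eqVneq => [->|_]; rewrite dk0 mulr0 ?mul0rn oppr0.
have /eqP := eq_gram k; rewrite gram_A_diag -subr_eq0 addrC addKr oppr_eq0.
rewrite mulf_eq0 (negPf dk0) addr_eq0 => /eqP/esym eq2 /=.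
(* The vanishing defect says that [U k k] has real part -1, while its modulus is at most 1. *)
have U1 : `|U k k| = 1.
  apply/le_anti; rewrite norm_U_diag /= -(@ler_pM2l _ 2) ?ltr0n // mulr1.
  have := addC_conjC_le (- U k k).
  by rewrite normrN rmorphN /= -opprD eq2.
have Ukk : U k k = -1.
  have := addC_conjC_eq (- U k k).
  rewrite normrN rmorphN /= -opprD eq2 U1 mulr1 => /(_ erefl) <-.
  by rewrite opprK.
have [->|ik] := eqVneq i k; first by rewrite Ukk mulN1r mulr1n.
(* Column [k] of [U] has norm 1, which the diagonal entry already exhausts. *)
rewrite mulr0n oppr0 (gram_diag_eq _ U k) ?mul0r //.
by rewrite gram_U mxE eqxx Ukk normrN normr1 expr1n.
Qed.

(** * The lower bound, through [V] *)

Hypothesis d_lt1 : forall k, d k < 1.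
Hypothesis A_unit : A \in unitmx.
Local Notation W := (invmx A).
Local Notation t k := (sqrtC (1 - d k ^+ 2)).
Local Notation T := (diag_mx (\row_k t k)).
Local Notation V := (T *m W *m T).

Lemma sub1d2_gt0 k : 0 < 1 - d k ^+ 2.
Proof. by rewrite subr_gt0 expr_lt1. Qed.

Lemma conjC_t k : (t k)^* = t k.
Proof. by rewrite geC0_conj ?sqrtC_ge0 ?ltW ?sub1d2_gt0. Qed.

Lemma adj_T : T^t* = T.
Proof.
by apply/matrixP => i j; rewrite !mxE rmorphMn /= conjC_t; case: eqVneq => [->|].
Qed.

Lemma sqr_T : T *m T = 1%:M - D *m D.
Proof.
apply/matrixP => i j; rewrite !mul_mx_diag !mxE.
have [->|_] := eqVneq i j; last by rewrite !mulr0n !mul0r subr0.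
by rewrite !mulr1n -!expr2 sqrtCK.
Qed.

(** Multiply [T *m T = A^t* + A - A^t* *m A] by the adjoint of [W] on the left and by [W] on the
    right. *)
Lemma gram_TW : W^t* *m (T *m T) *m W = W + W^t* - 1%:M.
Proof.
have WA : W *m A = 1%:M by rewrite mulVmx.
have AW : A *m W = 1%:M by rewrite mulmxV.
have WAC : W^t* *m A^t* = 1%:M.
  by rewrite -map_mxM -trmx_mul AW trmx1 map_mx1.
have -> : T *m T = A^t* + A - A^t* *m A.
  by rewrite gram_A sqr_T opprB [RHS]addrC subrK.
rewrite mulmxBr mulmxDr mulmxA WAC mul1mx mulmxBl mulmxDl mul1mx.
by rewrite -mulmxA AW mulmx1.
Qed.

Lemma entry_V i j : V i j = t i * W i j * t j.
Proof. by rewrite mul_mx_diag mxE mul_diag_mx !mxE. Qed.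

Lemma gram_V_diag k :
  (V^t* *m V) k k = V k k + (V k k)^* - (1 - d k ^+ 2).
Proof.
have -> : V^t* *m V = T *m (W + W^t* - 1%:M) *m T.
  by rewrite -gram_TW !trmx_mul !map_mxM /= adj_T !mulmxA.
rewrite mul_mx_diag mxE mul_diag_mx entry_V !mxE eqxx !rmorphM /= !conjC_t.
by move: (sqrtCK (1 - d k ^+ 2)); move: (t k) => s <-; ring.
Qed.

Lemma gram_V_diag_le k : (V^t* *m V) k k <= 2 * `|V k k| - (1 - d k ^+ 2).
Proof. by rewrite gram_V_diag lerB // addC_conjC_le. Qed.

Lemma norm_V_diag_le k : `|V k k| <= 1 + d k.
Proof. exact: sqr_sub_bound (gram_diag_ge _ V k k) (gram_V_diag_le k). Qed.

(** The bound [2 y - (1 - d k ^+ 2)] increases with [y], and at the largest value [y = 1 + d k] it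
    is exactly the square. *)
Lemma gram_V_diag_le_sqr k : (V^t* *m V) k k <= (1 + d k) ^+ 2.
Proof.
rewrite (le_trans (gram_V_diag_le k)) //.
rewrite (_ : (1 + d k) ^+ 2 = 2 * (1 + d k) - (1 - d k ^+ 2)); last by ring.
by rewrite lerB // ler_wpM2l ?norm_V_diag_le.
Qed.

(** The product does not depend on [U], so an upper bound for [det V] becomes a lower bound for
    [det A]. *)
Lemma det_V : \det V * \det A = \prod_k (1 + d k) * \prod_k (1 - d k).
Proof.
rewrite !det_mulmx mulrAC det_inv mulrVK -?unitmxE // -det_mulmx.
rewrite sqr_T det_trig; last first.
  rewrite -sqr_T; apply/is_trig_mxP => i j lt_ij; rewrite mul_mx_diag !mxE.
  by rewrite -val_eqE ltn_eqF // mulr0n mul0r.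
by rewrite -big_split; apply: eq_bigr => k _; rewrite diag_subD2 /=; ring.
Qed.

Lemma prod_add1d_gt0 : 0 < \prod_k (1 + d k).
Proof. by rewrite prodr_gt0 // => k _; apply: add1d_gt0. Qed.

Lemma prod_sub1d_gt0 : 0 < \prod_k (1 - d k).
Proof. by rewrite prodr_gt0 // => k _; rewrite subr_gt0. Qed.

Lemma norm_det_V :
  `|\det V| * `|\det A| = \prod_k (1 + d k) * \prod_k (1 - d k).
Proof.
rewrite -normrM det_V gtr0_norm //.
by rewrite mulr_gt0 ?prod_add1d_gt0 ?prod_sub1d_gt0.
Qed.

Lemma norm_det_V_le : `|\det V| <= \prod_k (1 + d k).
Proof.
rewrite -(@ler_pXn2r _ 2) ?nnegrE ?(ltW prod_add1d_gt0) //.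
rewrite (le_trans (hadamard _ V)) // -prodrXl; apply: ler_prod => k _.
by rewrite gram_diag_ge0 gram_V_diag_le_sqr.
Qed.

Lemma det_one_sub_ge : \prod_k (1 - d k) <= `|\det A|.
Proof.
by rewrite -(ler_pM2l prod_add1d_gt0) -norm_det_V ler_wpM2r ?norm_det_V_le.
Qed.

Lemma det_one_sub_eq_min : `|\det A| = \prod_k (1 - d k) -> U *m D = D.
Proof.
move=> eq_det.
have eq_detV : `|\det V| = \prod_k (1 + d k).
  by have := norm_det_V; rewrite eq_det => /(mulIf (lt0r_neq0 prod_sub1d_gt0)).
have eq_gram k : (V^t* *m V) k k = (1 + d k) ^+ 2.
  move: k; apply: prodr_eq_bound => [k|k|].
    by rewrite gram_diag_ge0 gram_V_diag_le_sqr.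
    by rewrite exprn_gt0 ?add1d_gt0.
  apply/le_anti/andP; split.
    by apply: ler_prod => k _; rewrite gram_diag_ge0 gram_V_diag_le_sqr.
  by rewrite prodrXl -eq_detV hadamard.
have addV k : V k k + (V k k)^* = 2 * (1 + d k).
  rewrite -[LHS](subrK (1 - d k ^+ 2)) -gram_V_diag eq_gram; ring.
have normV k : `|V k k| = 1 + d k.
  apply/le_anti; rewrite norm_V_diag_le /= -(@ler_pM2l _ 2) ?ltr0n // -addV.
  exact: addC_conjC_le.
have Vkk k : V k k = 1 + d k.
  by rewrite -[RHS]normV; apply: addC_conjC_eq; rewrite addV normV.
have t_neq0 k : t k != 0 by rewrite sqrtC_eq0 lt0r_neq0 ?sub1d2_gt0.
(* [V] is diagonal with entries [1 + d k]; undoing the scaling by [T] makes [W] the inverse of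
   [1 - D]. *)
have W1D : W *m (1%:M - D) = 1%:M.
  apply/matrixP => i j.
  have -> : (W *m (1%:M - D)) i j = W i j * (1 - d j).
    by rewrite mulmxBr mulmx1 mulrBr mulr1 -mulmx_D !mxE.
  rewrite mxE; have [->|ij] := eqVneq i j; last first.
    have /eqP : V i j = 0.
      by apply: gram_diag_eq => //; rewrite normV eq_gram.
    by rewrite entry_V !mulf_eq0 !(negPf (t_neq0 _)) orbF => /eqP ->;
      rewrite !mul0r.
  (* The factor [1 + d j] completes [1 - d j] to the square of [t j]. *)
  apply: (mulfI (lt0r_neq0 (add1d_gt0 j))); rewrite !mulr1 -[RHS]Vkk entry_V.
  by rewrite -mulrA (mulrC (t j)) -mulrA -expr2 sqrtCK; ring.
have : A = 1%:M - D by rewrite -[RHS](mulKVmx A_unit) W1D mulmx1.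
by move/addrI/oppr_inj.
Qed.

End DiagonalBounds.
End Gram.

(** * Characteristic polynomials and unitary diagonalization *)

Section Diagonalization.
Variables (C : numClosedFieldType) (n : nat).

Lemma char_poly_unitary_conj (P M : 'M[C]_n) : P \is unitarymx ->
  char_poly (P^t* *m M *m P) = char_poly M.
Proof.
move=> Pu; have PP : P^t* *m P = 1%:M by apply/mulmx1C/unitarymxP.
have PPpoly : map_mx polyC (P^t*) *m map_mx polyC P = 1%:M.
  by rewrite -map_mxM PP map_mx1.
rewrite /char_poly.
have -> : char_poly_mx (P^t* *m M *m P) =
    map_mx polyC (P^t*) *m char_poly_mx M *m map_mx polyC P.
  rewrite /char_poly_mx mulmxBr mulmxBl -!map_mxM mul_mx_scalar -scalemxAl.
  by rewrite PPpoly scalemx1.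
by rewrite !det_mulmx mulrAC -det_mulmx PPpoly det1 mul1r.
Qed.

Lemma char_poly_diag (d : 'I_n -> C) :
  char_poly (diag_mx (\row_k d k)) = \prod_k ('X - (d k)%:P).
Proof.
rewrite char_poly_trig ?diag_mx_is_trig //.
by apply: eq_bigr => k _; rewrite !mxE eqxx.
Qed.

Lemma det_one_sub_char_poly (M : 'M[C]_n) :
  \det (1%:M - M) = (char_poly M).[1].
Proof.
rewrite /char_poly -horner_evalE -det_map_mx; congr (\det _).
apply/matrixP => i j; rewrite !mxE /= /horner_eval !hornerE.
by rewrite hornerMn hornerX.
Qed.

Lemma psdmx_diag (Z : 'M[C]_n) (r : 'I_n -> C) :
  psdmx Z -> char_poly Z = \prod_k ('X - (r k)%:P) ->
  (forall k, 0 <= r k) /\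
  exists2 P : 'M[C]_n, P \is unitarymx & Z = P^t* *m diag_mx (\row_k r k) *m P.
Proof.
move=> [ZC Zpos] Zr.
have /orthomx_spectralP : Z \is normalmx by apply/normalmxP; rewrite ZC.
set P := spectralmx Z; set sp := spectral_diag Z.
have Pu : P \is unitarymx by apply: spectral_unitarymx.
rewrite invmx_unitary // => ZE.
have spE : diag_mx sp = diag_mx (\row_k sp 0 k).
  by congr diag_mx; apply/rowP => k; rewrite mxE.
(* The quadratic form of [Z] at the [k]-th row of [P] is the [k]-th spectral value. *)
have sp_ge0 k : 0 <= sp 0 k.
  have := Zpos (row k P).
  have -> : row k P *m Z *m (row k P)^t* = row k (diag_mx sp *m P) *m (row k P)^t*.
    congr (_ *m _); rewrite -row_mul; congr row.
    by rewrite [X in _ *m X]ZE !mulmxA (unitarymxP Pu) mul1mx.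
  rewrite row_mul row_diag_mx -scalemxAl -rowE -scalemxAl mxE.
  have := row_unitarymxP Pu k k; rewrite dotmxE => ->.
  by rewrite eqxx mulr1.
(* Unique factorization of the characteristic polynomial matches [r] with the spectral values up to
   a permutation [s]; permuting the rows of [P] by [s] then puts [r] in its given order. *)
have /prod_XsubC_eq : \prod_(x <- [tuple r k | k < n]) ('X - x%:P) =
    \prod_(x <- [tuple sp 0 k | k < n]) ('X - x%:P).
  rewrite !big_tuple; under eq_bigr do rewrite tnth_mktuple.
  under [RHS]eq_bigr do rewrite tnth_mktuple.
  by rewrite -Zr ZE char_poly_unitary_conj // spE char_poly_diag.
case/tuple_permP => s rs.
have rE k : r k = sp 0 (s k).
  have := congr1 (fun t => nth 0 t k) rs.
  by rewrite -!tnth_nth !tnth_mktuple.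
split=> [k|]; first by rewrite rE.
exists (row_perm s P).
  apply/row_unitarymxP => i j.
  have rowP k : row k (row_perm s P) = row (s k) P.
    by apply/rowP => l; rewrite !mxE.
  by rewrite !rowP (row_unitarymxP Pu) (inj_eq perm_inj).
rewrite [LHS]ZE; apply/matrixP => i j.
rewrite !mul_mx_diag !mxE (reindex_inj (@perm_inj _ s)) /=.
by apply: eq_bigr => k _; rewrite !mxE rE.
Qed.

End Diagonalization.

(** * Both inequalities and their equality cases, from the diagonal bounds *)

Theorem theorem3 (C : numClosedFieldType) (n : nat) (Z U : 'M[C]_n)
  (r : 'I_n -> C) :
  psdmx Z ->
  char_poly Z = \prod_(k < n) ('X - (r k)%:P) ->
  U \is unitarymx ->
  (1%:M - U *m Z) \in unitmx ->
  let lhs1 := \prod_(k < n) (`|1 - r k| / (1 + r k)) in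
  let rhs1 := `|\det (1%:M - Z *m Z)| / `|\det (1%:M - U *m Z)| ^+ 2 in
  [/\ lhs1 <= rhs1,
      lhs1 = rhs1 <->
        (eigenvalue Z 1 \/
         char_poly (U *m Z) = \prod_(k < n) ('X + (r k)%:P)),
      Z \in unitmx -> (1%:M - Z) \in unitmx -> U != - 1%:M -> lhs1 < rhs1 &
      (forall k, r k < 1) ->
      let lhs2 := \det (1%:M - Z *m Z) / `|\det (1%:M - U *m Z)| ^+ 2 in
      let rhs2 := \prod_(k < n) ((1 + r k) / (1 - r k)) in
      [/\ lhs2 <= rhs2,
          lhs2 = rhs2 <->
            char_poly (U *m Z) = \prod_(k < n) ('X - (r k)%:P) &
          Z \in unitmx -> U != 1%:M -> lhs2 < rhs2]].
Proof.
move=> Zpsd Zr Uu UZ_unit lhs1 rhs1.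
have [r_ge0 [P Pu ZE]] := psdmx_diag _ _ Z r Zpsd Zr.
set D := diag_mx _ in ZE.
have PP : P^t* *m P = 1%:M by apply/mulmx1C/unitarymxP.
(* [U *m Z] is unitarily similar to [U' *m D], to which the diagonal bounds apply. *)
pose U' := P *m U *m P^t*.
have U'u : U' \is unitarymx by rewrite !mul_unitarymx ?trmxC_unitary.
have UZE : U *m Z = P^t* *m (U' *m D) *m P.
  by rewrite ZE /U' !mulmxA PP mul1mx.
have detUZ : \det (1%:M - U *m Z) = \det (1%:M - U' *m D).
  by rewrite !det_one_sub_char_poly UZE char_poly_unitary_conj.
pose p := \prod_k (1 + r k); pose q := \prod_k (1 - r k).
have r1_gt0 k : 0 < 1 + r k by rewrite ltr_pwDl.
have p_gt0 : 0 < p by rewrite prodr_gt0.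
have detN (M : 'M[C]_n) (s : 'I_n -> C) : char_poly M = \prod_k ('X - (s k)%:P) ->
    \det (1%:M - M) = \prod_k (1 - s k).
  move=> Ms; rewrite det_one_sub_char_poly Ms horner_prod.
  by apply: eq_bigr => k _; rewrite !hornerE.
have charN : char_poly (- Z) = \prod_k ('X - (- r k)%:P).
  rewrite ZE -mulNmx -mulmxN char_poly_unitary_conj // -char_poly_diag.
  congr char_poly; apply/matrixP => i j; rewrite !mxE.
  by case: eqVneq; rewrite ?mulr0n ?oppr0 ?mulr1n.
have detZ2 : \det (1%:M - Z *m Z) = q * p.
  have -> : 1%:M - Z *m Z = (1%:M - Z) *m (1%:M - - Z).
    by rewrite opprK mulmxDr mulmx1 mulmxBl mul1mx addrA subrK.
  rewrite det_mulmx (detN _ _ Zr) (detN _ _ charN); congr (_ * _).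
  by apply: eq_bigr => k _; rewrite opprK.
pose a := `|\det (1%:M - U *m Z)|.
have a_gt0 : 0 < a by rewrite normr_gt0 -unitfE -unitmxE.
have a2_gt0 : 0 < a ^+ 2 by rewrite exprn_gt0.
have le_ap : a <= p by rewrite /a detUZ det_one_sub_le.
have eq_ap : a = p -> U *m Z = - Z.
  rewrite /a detUZ => /(det_one_sub_eq _ _ _ _ U'u r_ge0) UD.
  by rewrite UZE UD mulmxN mulNmx -ZE.
(* Some [r k] may exceed 1 here, so [q] has no fixed sign and its absolute value stays. *)
have lhs1E : lhs1 = `|q| / p by rewrite /lhs1 prodf_div normr_prod.
have rhs1E : rhs1 = `|q| * p / a ^+ 2.
  by rewrite /rhs1 detZ2 normrM (gtr0_norm p_gt0).
have eig1 : eigenvalue Z 1 = (q == 0).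
  by rewrite eigenvalue_root_char /root -det_one_sub_char_poly (detN _ _ Zr).
(* Clearing denominators leaves [a ^+ 2 <= p ^+ 2] with the common factor [|q|]; its vanishing is
   the equality case of eigenvalue 1. *)
have le1 : lhs1 <= rhs1.
  rewrite lhs1E rhs1E ler_pdivrMr // mulrAC ler_pdivlMr // -mulrA.
  apply: ler_wpM2l => //.
  by rewrite -expr2 ler_pXn2r ?nnegrE ?(ltW a_gt0, ltW p_gt0).
have eq1 : lhs1 = rhs1 -> q != 0 -> U *m Z = - Z.
  move=> /eqP; rewrite lhs1E rhs1E eqr_div ?(lt0r_neq0 a2_gt0, lt0r_neq0 p_gt0) //.
  rewrite -mulrA -expr2 => /eqP.
  move=> eq_ap2 q0; apply: eq_ap; move: eq_ap2.
  move=> /(mulfI _); rewrite normr_eq0 => /(_ q0)/eqP.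
  by rewrite eqrXn2 ?ltW // => /eqP.
split=> //.
- split=> [eq_lr|[|UZr]].
  + have [q0|q0] := eqVneq q 0; first by left; rewrite eig1 q0.
    right; rewrite eq1 // charN; apply: eq_bigr => k _.
    by rewrite polyCN opprK.
  + by rewrite eig1 lhs1E rhs1E => /eqP ->; rewrite normr0 !mul0r.
  + rewrite lhs1E rhs1E.
    suff -> : a = p.
      by rewrite expr2 invfM mulrA mulfK ?lt0r_neq0.
    rewrite /a (detN _ (fun k => - r k)); last first.
      by rewrite UZr; apply: eq_bigr => k _; rewrite polyCN opprK.
    by under eq_bigr do rewrite opprK; rewrite gtr0_norm.
- move=> Zu Z1u UN1; rewrite lt_neqAle le1 andbT.
  (* Equality gives [U *m Z = - Z], and cancelling the invertible [Z] gives [U = -1]. *)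
  apply: contraNneq UN1 => /eq1 UZ; apply/eqP.
  rewrite -[U](mulmxK Zu) UZ ?mulNmx ?mulmxV //.
  by rewrite /q -(detN _ _ Zr) -unitfE -unitmxE.
move=> r_lt1 lhs2 rhs2.
have q_gt0 : 0 < q by rewrite prodr_gt0 // => k _; rewrite subr_gt0.
have lhs2E : lhs2 = q * p / a ^+ 2 by rewrite /lhs2 detZ2.
have rhs2E : rhs2 = p / q by rewrite /rhs2 prodf_div.
have UD_unit : 1%:M - U' *m D \in unitmx.
  by rewrite unitmxE -detUZ -unitmxE.
have le_qa : q <= a by rewrite /a detUZ det_one_sub_ge.
have eq_qa : a = q -> U *m Z = Z.
  rewrite /a detUZ.
  move=> /(det_one_sub_eq_min _ _ _ _ U'u r_ge0 r_lt1 UD_unit) UD.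
  by rewrite UZE UD -ZE.
(* Clearing denominators leaves [q ^+ 2 <= a ^+ 2] with the positive common factor [p]. *)
have le2 : lhs2 <= rhs2.
  rewrite lhs2E rhs2E ler_pdivrMr // mulrAC ler_pdivlMr // mulrAC mulrC.
  apply: ler_wpM2l; first exact: ltW.
  by rewrite -expr2 ler_pXn2r ?nnegrE ?(ltW a_gt0, ltW q_gt0).
have eq2 : lhs2 = rhs2 -> U *m Z = Z.
  move=> /eqP; rewrite lhs2E rhs2E eqr_div ?lt0r_neq0 // mulrAC mulrC => /eqP.
  move=> /(mulfI (lt0r_neq0 p_gt0))/esym/eqP.
  by rewrite -expr2 eqrXn2 ?ltW // => /eqP/eq_qa.
split=> //.
- split=> [/eq2 -> //|UZr]; rewrite lhs2E rhs2E.
  rewrite /a (detN _ _ UZr) gtr0_norm // expr2 invfM mulrA (mulrC q).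
  by rewrite mulfK ?lt0r_neq0.
move=> Zu U1; rewrite lt_neqAle le2 andbT.
apply: contraNneq U1 => /eq2 UZ; apply/eqP.
by rewrite -[U](mulmxK Zu) UZ mulmxV.
Qed.
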